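(* For $n\ge1$ and $k\ge0$, $$\sum_{\sigma\in\mathcal{P}_{n,k}}\alpha^{\mathrm{lmi}(\sigma)-1}\beta^{\mathrm{rmi}(\sigma)-1}=\sum_{\sigma\in\mathcal{L}_{n-1,k}}(\alpha+\beta)^{\mathrm{rmi}(\sigma)},$$ where $\mathcal{P}_{n,k}=\{\sigma\in\mathfrak{S}_n:\widetilde{\mathrm{M}}(\sigma)=k\}$ and $\mathcal{L}_{n-1,k}=\{\sigma\in\mathfrak{S}_{n-1}:\mathrm{M}_0(\sigma)=k\}$. Consequently, if $\gamma_{n,k}(\alpha,\beta)$ are defined by the expansion $$A_n\Big(x,y\,\Big|\,\tfrac{\alpha+\beta}{2},\tfrac{\alpha+\beta}{2}\Big)=\sum_{k=0}^{\lfloor (n-1)/2\rfloor}\gamma_{n,k}(\alpha,\beta)(xy)^k(x+y)^{n-2k-1},$$ then $\gamma_{n,k}(\alpha,\beta)=2^{2k+1-n}\sum_{\sigma\in\mathcal{L}_{n-1,k}}(\alpha+\beta)^{\mathrm{rmi}(\sigma)}$.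
   Context: $\mathfrak{S}_n$ is the set of permutations of $[n]$ ($\mathfrak{S}_0$ contains only the empty permutation). $\mathrm{lmi},\mathrm{rmi}$ count left-to-right minima and right-to-left minima. $\widetilde{\mathrm{M}}(\sigma)$ is the number of $i\in[n]$ with $\sigma_{i-1}<\sigma_i>\sigma_{i+1}$ under the convention $\sigma_0=\sigma_{n+1}=+\infty$; $\mathrm{M}_0(\sigma)$ is the number of such $i$ under the convention $\sigma_0=0$, $\sigma_{n+1}=+\infty$. The Stirling–Eulerian polynomial is $A_n(x,y|\alpha,\beta)=\sum_{\sigma\in\mathfrak{S}_n}x^{\mathrm{asc}(\sigma)}y^{\mathrm{des}(\sigma)}\alpha^{\mathrm{lma}(\sigma)-1}\beta^{\mathrm{rma}(\sigma)-1}$, where $\mathrm{asc},\mathrm{des}$ count indices $i\in[n-1]$ with $\sigma_i<\sigma_{i+1}$, resp. $\sigma_i>\sigma_{i+1}$, and $\mathrm{lma},\mathrm{rma}$ count left-to-right and right-to-left maxima. *)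

(* Defs.v *)
From HB Require Import structures.
From mathcomp Require Import all_boot all_order all_algebra all_fingroup.

Set Implicit Arguments.
Unset Strict Implicit.
Unset Printing Implicit Defensive.

Import GRing.Theory.

(* A permutation of [n] = {1, ..., n} is an s : 'S_n acting on {0, ..., n-1}; *)
(* positions stay 0-based, but the letters of its word are shifted into [n],  *)
(* so that 0 is available as a boundary value below every letter.             *)

Section Statistics.

Variable n : nat.
Implicit Type s : 'S_n.

Definition word s : seq nat := [seq (s i).+1 | i <- enum 'I_n].

Definition lmi s : nat :=
  #|[set i : 'I_n | [forall j : 'I_n, (j < i) ==> (s i < s j)]]|.

Definition rmi s : nat :=
  #|[set i : 'I_n | [forall j : 'I_n, (i < j) ==> (s i < s j)]]|.

Definition lma s : nat :=
  #|[set i : 'I_n | [forall j : 'I_n, (j < i) ==> (s j < s i)]]|.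

Definition rma s : nat :=
  #|[set i : 'I_n | [forall j : 'I_n, (i < j) ==> (s j < s i)]]|.

Definition asc s : nat :=
  #|[set i : 'I_n.-1 | nth 0 (word s) i < nth 0 (word s) i.+1]|.

Definition des s : nat :=
  #|[set i : 'I_n.-1 | nth 0 (word s) i > nth 0 (word s) i.+1]|.

(* The letter s_i of the word extended by s_0 = l and s_(n+1) = r (the latter *)
(* through the default value of nth).                                         *)
Definition letter (l r : nat) s (i : nat) : nat := nth r (l :: word s) i.

(* i : 'I_n stands for the 1-based position i.+1. *)
Definition peaks (l r : nat) s : nat :=
  #|[set i : 'I_n | (letter l r s i < letter l r s i.+1)
                 && (letter l r s i.+1 > letter l r s i.+2)]|.

(* Since all letters are at most n, the boundary value n.+1 plays +oo. *)
Definition Mtilde s : nat := peaks n.+1 n.+1 s.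
Definition M0 s : nat := peaks 0 n.+1 s.

End Statistics.

Definition Pset (n k : nat) : {set 'S_n} := [set s : 'S_n | Mtilde s == k].
Definition Lset (n k : nat) : {set 'S_n} := [set s : 'S_n | M0 s == k].

Local Open Scope ring_scope.

Definition stirling_eulerian (R : comNzRingType) (n : nat) (x y a b : R) : R :=
  \sum_(s : 'S_n)
    x ^+ asc s * y ^+ des s * a ^+ (lma s - 1) * b ^+ (rma s - 1).

(* An identity of polynomials over R in two indeterminates, x := 'X and       *)
(* y := 'X%:P; constants of R are embedded by c%:P%:P.                        *)
Definition gamma_expansion (R : comUnitRingType) (n : nat) (alpha beta : R)
    (gamma : nat -> R) : Prop :=
  let x : {poly {poly R}} := 'X in
  let y : {poly {poly R}} := 'X%:P in
  let t : {poly {poly R}} := ((alpha + beta) / 2%:R)%:P%:P in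
  stirling_eulerian n x y t t =
    \sum_(0 <= k < ((n - 1)./2).+1)
      (gamma k)%:P%:P * (x * y) ^+ k * (x + y) ^+ (n - 2 * k - 1).

(* Main.v *)
Require Import Defs.
From HB Require Import structures.
From mathcomp Require Import all_boot all_order all_algebra all_fingroup.
From mathcomp Require Import zify ring.

(* Inserting a new maximum next to a peak keeps the number of peaks, and      *)
(* inserting it in another inner gap raises it by one; in an end gap facing   *)
(* +oo it creates no peak but a new record. With 2k gaps adjacent to the k    *)
(* peaks, the distributions of Mtilde on S_(n+1) and of M0 on S_n obey the    *)
(* same recurrence with the weight alpha + beta of the end gaps, so they      *)
(* agree. Dually, inserting a new minimum gives a differential recurrence for *)
(* A_n, which on the basis (xy)^k ((x + y)/2)^(n-1-2k) is again that same     *)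
(* recurrence.                                                                *)

Set Implicit Arguments.
Unset Strict Implicit.
Unset Printing Implicit Defensive.

Import GRing.Theory.
Local Open Scope ring_scope.

(** Each permutation of n+1 letters arises exactly once by inserting a largest (or a smallest)
    letter into a permutation of n letters ([sum_lift_perm]), so recurrences come from summing over
    gaps. Tested against an arbitrary function [phi] of the peak count, both peak sums evolve by one
    operator, [transfer] ([sum_M0_rec], [sum_Mtilde_rec]); induction gives [sum_Mtilde_M0], and
    indicator functions [phi] give the first identity.

    For the second, [stirling_eulerian_M0] expands A_(n+1) directly as a sum over S_n of (xy)^k
    q^(n-2k) (2t)^rmi with k = [M0] and q = (x+y)/2; at t = (alpha+beta)/2 the weight 2t is
    alpha+beta. Collecting the powers of 1/2 gives one valid family gamma, and [gamma_basis_free]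
    shows that it is the only one on the indices in range. *)

(** * Insertion of an extreme letter and its effect on records *)

Lemma lift_perm_bij n (j : 'I_n.+1) :
  bijective (fun p : 'S_n * 'I_n.+1 => lift_perm p.2 j p.1).
Proof.
apply: inj_card_bij; last first.
  by rewrite card_prod !card_Sn card_ord factS mulnC.
move=> [s i] [s' i'] /= eq_ss'.
have eq_i : i = i'.
  apply: (@perm_inj _ (lift_perm i j s)).
  by rewrite lift_perm_id eq_ss' lift_perm_id.
rewrite -eq_i in eq_ss' *; congr pair; apply/permP=> k.
apply: (@lift_inj _ j).
by rewrite -(lift_perm_lift i j s) eq_ss' lift_perm_lift.
Qed.

Lemma sum_lift_perm (V : nmodType) n (j : 'I_n.+1) (F : 'S_n.+1 -> V) :
  \sum_s F s = \sum_(s : 'S_n) \sum_(i : 'I_n.+1) F (lift_perm i j s).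
Proof.
rewrite pair_big /= (reindex (fun p : 'S_n * 'I_n.+1 => lift_perm p.2 j p.1)) //.
exact: onW_bij (lift_perm_bij j).
Qed.

Definition records (p r : rel nat) n (s : 'S_n) : nat :=
  #|[set i : 'I_n | [forall j : 'I_n, p j i ==> r (s i) (s j)]]|.

(** An old letter beats the new one, so old records survive and no new ones appear among old
    letters; the new letter loses to every old one, so it is a record only if no position comes
    before it for [p]. With [p] and [r] among [ltn] and [gtn] this covers all four record
    statistics. *)
Lemma records_lift (p r : rel nat) n (s : 'S_n) (i j : 'I_n.+1) :
    (forall k l, p (bump i k) (bump i l) = p k l) -> ~~ p i i ->
    (forall k l, r (bump j k) (bump j l) = r k l) ->
    (forall k, (k < n)%N -> r (bump j k) j /\ ~~ r j (bump j k)) ->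
  records p r (lift_perm i j s)
    = ([forall k : 'I_n, ~~ p (bump i k) i] + records p r s)%N.
Proof.
move=> pE pii rE rj; rewrite /records -!sum1_card.
rewrite big_mkcond (bigD1_ord i) //= inE; congr addn.
  rewrite (_ : [forall k, _] = [forall k : 'I_n, ~~ p (bump i k) i]); first by case: ifP.
  apply/forallP/forallP => [h k | h k].
    have := h (lift i k); rewrite lift_perm_id lift_perm_lift /=.
    have [_ /negbTE->] := rj (s k) (ltn_ord _).
    by rewrite implybF.
  have [k' ->|->] := unliftP i k; last by rewrite (negbTE pii).
  by rewrite /= (negbTE (h k')).
rewrite [RHS]big_mkcond /=; apply: eq_bigr => k _; rewrite !inE.
congr (if _ then _ else _); apply/forallP/forallP => [h l | h l].
  by have := h (lift i l); rewrite !lift_perm_lift /= pE rE.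
have [l' ->|->] := unliftP i l; first by rewrite !lift_perm_lift /= pE rE.
by rewrite lift_perm_id lift_perm_lift /=; have [-> _] := rj (s k) (ltn_ord _); rewrite implybT.
Qed.

Lemma ltn_bump2 i k l : (bump i k < bump i l)%N = (k < l)%N.
Proof. rewrite /bump; lia. Qed.

Lemma no_bump_lt n (i : 'I_n.+1) :
  [forall k : 'I_n, ~~ (bump i k < i)%N] = (i == ord0).
Proof.
apply/forallP/eqP => [h|-> //]; apply/val_inj=> /=; apply/eqP/negPn/negP => i0.
have k_lt : (0 < n)%N by have := ltn_ord i; lia.
by have := h (Ordinal k_lt); rewrite /= /bump; lia.
Qed.

Lemma no_bump_gt n (i : 'I_n.+1) :
  [forall k : 'I_n, ~~ (i < bump i k)%N] = (i == ord_max).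
Proof.
apply/forallP/eqP => [h|-> k]; last by have := ltn_ord k; rewrite /= /bump; lia.
apply/val_inj=> /=; apply/eqP/negPn/negP => i_n.
have i_lt : (i < n)%N by have := ltn_ord i; lia.
by have := h (Ordinal i_lt); rewrite /= /bump; lia.
Qed.

Section InsertionRecords.
Variables (n : nat) (s : 'S_n) (i : 'I_n.+1).

Lemma lmi_lift_max : lmi (lift_perm i ord_max s) = ((i == ord0) + lmi s)%N.
Proof.
rewrite -no_bump_lt; apply: (@records_lift ltn ltn) => //=; rewrite ?ltnn //.
- exact: ltn_bump2.
- exact: ltn_bump2.
by move=> k; rewrite /bump; lia.
Qed.

Lemma rmi_lift_max : rmi (lift_perm i ord_max s) = ((i == ord_max) + rmi s)%N.
Proof.
rewrite -no_bump_gt; apply: (@records_lift gtn ltn) => //=; rewrite ?ltnn //.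
- by move=> *; apply: ltn_bump2.
- exact: ltn_bump2.
by move=> k; rewrite /bump; lia.
Qed.

Lemma lma_lift_min : lma (lift_perm i ord0 s) = ((i == ord0) + lma s)%N.
Proof.
rewrite -no_bump_lt; apply: (@records_lift ltn gtn) => //=; rewrite ?ltnn //.
exact: ltn_bump2.
Qed.

Lemma rma_lift_min : rma (lift_perm i ord0 s) = ((i == ord_max) + rma s)%N.
Proof.
rewrite -no_bump_gt; apply: (@records_lift gtn gtn) => //=; rewrite ?ltnn //.
by move=> *; apply: ltn_bump2.
Qed.

End InsertionRecords.

Lemma lmi_gt0 n (s : 'S_n.+1) : (0 < lmi s)%N.
Proof. by apply/card_gt0P; exists ord0; rewrite inE; apply/forallP. Qed.

Lemma lma_gt0 n (s : 'S_n.+1) : (0 < lma s)%N.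
Proof. by apply/card_gt0P; exists ord0; rewrite inE; apply/forallP. Qed.

Lemma rmi_gt0 n (s : 'S_n.+1) : (0 < rmi s)%N.
Proof.
apply/card_gt0P; exists ord_max; rewrite inE; apply/forallP=> j /=.
by rewrite ltnNge -ltnS ltn_ord.
Qed.

Lemma rma_gt0 n (s : 'S_n.+1) : (0 < rma s)%N.
Proof.
apply/card_gt0P; exists ord_max; rewrite inE; apply/forallP=> j /=.
by rewrite ltnNge -ltnS ltn_ord.
Qed.

(** * Words: ascents, descents and peaks under insertion *)

Definition insert (m i : nat) (w : seq nat) := take i w ++ m :: drop i w.
Arguments insert : simpl never.

Lemma size_word n (s : 'S_n) : size (word s) = n.
Proof. by rewrite size_map size_enum_ord. Qed.

Lemma nth_word n (s : 'S_n) x0 (k : 'I_n) : nth x0 (word s) k = (s k).+1.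
Proof. by rewrite (nth_map k) ?size_enum_ord // nth_ord_enum. Qed.

Lemma all_word n (s : 'S_n) : all [pred a | 0 < a <= n]%N (word s).
Proof. by apply/allP=> a /mapP[k _ ->] /=. Qed.

Lemma uniq_word n (s : 'S_n) : uniq (word s).
Proof.
by rewrite map_inj_uniq ?enum_uniq // => k l [] /val_inj /perm_inj.
Qed.

Lemma word_lift n (s : 'S_n) (i j : 'I_n.+1) :
  word (lift_perm i j s) = insert j.+1 i (map (bump j.+1) (word s)).
Proof.
have lei : (i <= n)%N by rewrite -ltnS.
apply: (@eq_from_nth _ 0%N) => [|k].
  by rewrite size_cat /= size_takel ?size_drop size_map !size_word //; lia.
rewrite size_word => ltk; rewrite (nth_word _ _ (Ordinal ltk)).
rewrite nth_cat size_takel; last by rewrite size_map size_word.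
have nth_w (k' : 'I_n) : nth 0%N (map (bump j.+1) (word s)) k' = (bump j (s k')).+1.
  by rewrite (nth_map 0%N) ?size_word // nth_word /bump; lia.
have [k' eq_k|eq_k] := unliftP i (Ordinal ltk); last first.
  by rewrite eq_k lift_perm_id (congr1 val eq_k : k = i) ltnn subnn.
rewrite eq_k lift_perm_lift (congr1 val eq_k : k = lift i k') /= -nth_w.
rewrite /bump; case: (leqP i k') => [le_ik|lt_ki]; last by rewrite lt_ki nth_take.
rewrite ltnNge ltnW ?ltnS //= add1n subSn //= nth_drop.
by rewrite subnKC.
Qed.

Lemma insert0 m w : insert m 0 w = m :: w.
Proof. by rewrite /insert take0 drop0. Qed.

Lemma insertS m i a w : insert m i.+1 (a :: w) = a :: insert m i w.
Proof. by []. Qed.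

Lemma insert_size m w : insert m (size w) w = rcons w m.
Proof. by rewrite /insert take_size drop_size -cats1. Qed.

Fixpoint steps (r : rel nat) (a : nat) (w : seq nat) : nat :=
  if w is b :: w' then (r a b + steps r b w')%N else 0.

Lemma steps_rcons r a w b :
  steps r a (rcons w b) = (steps r a w + r (last a w) b)%N.
Proof. by elim: w a => [|c w IHw] a /=; rewrite ?addn0 ?add0n // IHw addnA. Qed.

Lemma steps_map r f a w : {mono f : x y / r x y} ->
  steps r (f a) (map f w) = steps r a w.
Proof. by move=> fr; elim: w a => //= b w IHw a; rewrite fr IHw. Qed.

Lemma steps_card r a w :
  steps r a w = #|[set i : 'I_(size w) | r (nth 0 (a :: w) i) (nth 0 w i)]|%N.
Proof.
rewrite -sum1_card big_mkcond /=; elim: w a => [|b w IHw] a /=.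
  by rewrite big_ord0.
rewrite big_ord_recl IHw inE /=; congr addn.
by apply: eq_bigr => i _; rewrite !inE.
Qed.

Lemma asc_steps n (s : 'S_n.+1) a w : word s = a :: w -> asc s = steps ltn a w.
Proof.
move=> ws; have sw : size w = n by have := size_word s; rewrite ws => -[].
by rewrite steps_card /asc ws; case: _ / sw.
Qed.

Lemma des_steps n (s : 'S_n.+1) a w : word s = a :: w -> des s = steps gtn a w.
Proof.
move=> ws; have sw : size w = n by have := size_word s; rewrite ws => -[].
by rewrite steps_card /des ws; case: _ / sw.
Qed.

(* The index i is the gap before the i-th letter of w: the two outer gaps of  *)
(* a :: w are excluded.                                                       *)
Lemma sum_insert_min (R : comNzRingType) (m a : nat) w (phi : nat -> nat -> R) :
    all (ltn m) (a :: w) -> uniq (a :: w) ->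
  let p := steps ltn a w in let q := steps gtn a w in
  \sum_(i < size w) phi (steps ltn a (insert m i w)) (steps gtn a (insert m i w))
    = phi p q.+1 *+ p + phi p.+1 q *+ q.
Proof.
elim: w a phi => [|b w IHw] a phi mw uw /=; first by rewrite big_ord0 !mulr0n addr0.
have [ma mw'] : (m < a)%N /\ all (ltn m) (b :: w) by case/andP: mw.
have mb : (m < b)%N by case/andP: mw'.
have [ma' mb'] : (a < m)%N = false /\ (b < m)%N = false by lia.
have [ab uw'] : (a != b) /\ uniq (b :: w).
  by case/andP: uw; rewrite inE negb_or => /andP[].
rewrite big_ord_recl insert0.
under eq_bigr => i _ do rewrite lift0 insertS.
rewrite /= ma mb ma' mb' /=.
have := IHw b (fun p q => phi ((a < b) + p)%N ((b < a) + q)%N) mw' uw' => /= ->.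
rewrite !add0n !add1n.
case: ltngtP ab => //= _ _; rewrite !add0n !add1n mulrS; first by rewrite addrA.
by rewrite addrCA.
Qed.

(* d records whether the step into a is ascending. *)
Fixpoint inner_peaks (d : bool) (a : nat) (w : seq nat) : nat :=
  if w is b :: w' then ((d && (b < a)) + inner_peaks (a < b) b w')%N else 0.

(** The step into [m] ascends, so the former last letter does not become a peak, and [m] itself is
    not interior. *)
Lemma inner_peaks_rcons d a w m : all (fun b => b < m)%N (a :: w) ->
  inner_peaks d a (rcons w m) = inner_peaks d a w.
Proof.
elim: w d a => [|b w IHw] d a /=.
  by rewrite andbT => /ltnW; rewrite leqNgt => /negbTE->; rewrite andbF.
by case/andP=> _ h; rewrite IHw.
Qed.

(** A peak is followed by a descent, so two peaks are never adjacent; [d] pays for a possible peak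
    at [a]. *)
Lemma inner_peaks_bound d a w : (2 * inner_peaks d a w <= size w + d)%N.
Proof.
elim: w d a => //= b w IHw d a; have := IHw (a < b)%N b.
case: (ltngtP a b) => /=; case: d => /=; lia.
Qed.

(* Exactly two gaps around each peak absorb the new letter; if a itself is a  *)
(* peak then the first of its two gaps lies outside the range.                *)
Lemma sum_insert_max (R : comNzRingType) d (m a : nat) w (phi : nat -> R) :
    all (fun b => b < m)%N (a :: w) ->
  let p := inner_peaks d a w in let e := d && (head a w < a)%N in
  \sum_(i < size w) phi (inner_peaks d a (insert m i w))
    = (p.*2%:R - e%:R) * phi p + ((size w)%:R - p.*2%:R + e%:R) * phi p.+1.
Proof.
elim: w d a phi => [|b w IHw] d a phi mw /=.
  by rewrite big_ord0 ltnn andbF /=; rewrite !subr0 addr0 !mul0r addr0.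
have [ma mw'] : (a < m)%N /\ all (fun b => b < m)%N (b :: w) by case/andP: mw.
have mb : (b < m)%N by case/andP: mw'.
have [ma' mb'] : (m < a)%N = false /\ (m < b)%N = false by lia.
rewrite big_ord_recl insert0.
under eq_bigr => i _ do rewrite lift0 insertS.
rewrite /= ma mb ma' andbF mb' /= add0n add1n.
have := IHw (a < b)%N b (fun p => phi ((d && (b < a)%N) + p)%N) mw' => /= ->.
(* Whether [b] is a peak is split off, so that every outcome of comparing [a] with [b] involves only
   [inner_peaks false b w]. *)
have -> : inner_peaks (a < b)%N b w
    = ((a < b)%N && (head b w < b)%N + inner_peaks false b w)%N.
  by case: (w) => [|c w''] /=; rewrite ?ltnn ?andbF ?addn0.
case: (ssrnat.ltngtP a b) => _ /=; rewrite ?andbF ?andbT ?add0n.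
- by case: (head b w < b)%N => /=; rewrite ?add0n ?add1n -!muln2; ring.
- by case: (d) => /=; rewrite ?add0n ?add1n -!muln2; ring.
by rewrite -!muln2 /=; ring.
Qed.

(** The right boundary is only the default [r] of [nth]: since it exceeds every letter, the last
    letter is never a peak, in accordance with [inner_peaks]. *)
Lemma inner_peaks_sum d l w r : (l <= r)%N -> all (fun a => a < r)%N w ->
  inner_peaks d l w = (d && (head r w < l)%N +
    \sum_(0 <= i < size w)
      ((nth r (l :: w) i < nth r w i) && (nth r w i.+1 < nth r w i)))%N.
Proof.
elim: w d l => [|b w IHw] d l le_lr /=; first by rewrite big_nil ltnNge le_lr andbF.
case/andP=> lt_br lt_wr.
by rewrite big_nat_recl //= (IHw _ _ (ltnW lt_br) lt_wr) -nth0.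
Qed.

Lemma peaks_inner n (s : 'S_n) l r : (l <= r)%N -> (n < r)%N ->
  peaks l r s = inner_peaks false l (word s).
Proof.
move=> le_lr lt_nr; rewrite (@inner_peaks_sum false l (word s) r) //; last first.
  by apply: sub_all (all_word s) => a /andP[_ /leq_ltn_trans->].
rewrite size_word big_mkord add0n /peaks -sum1_card big_mkcond /=.
by apply: eq_bigr => i _; rewrite inE /letter /=; case: ifP.
Qed.

Lemma map_bump_word_max n (s : 'S_n) : map (bump n.+1) (word s) = word s.
Proof.
apply: map_id_in => a /(allP (all_word s)) /andP[_ le_an].
by rewrite /bump ltnNge le_an.
Qed.

Lemma map_bump_word_min n (s : 'S_n) : map (bump 1) (word s) = map S (word s).
Proof.
by apply/eq_in_map => a /(allP (all_word s)) /andP[a_gt0 _]; rewrite /bump a_gt0.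
Qed.

(** Separates the two end gaps, where records change, from the inner ones. The booleans of [G] tell
    which end a gap is, the only dependence of the record counts on the gap. *)
Lemma sum_gaps (V : nmodType) n (G : bool -> bool -> nat -> V) :
  \sum_(i < n.+2) G (i == ord0) (i == ord_max) i
    = G true false 0 + G false true n.+1 + \sum_(i < n) G false false i.+1.
Proof.
rewrite big_ord_recl big_ord_recr /= [X in _ + X]addrC addrA eqxx.
congr (_ + _); first by rewrite -!val_eqE /= /bump /= !add1n eqxx.
apply: eq_bigr => i _.
by rewrite -!val_eqE /= /bump /= !add1n eqSS (ltn_eqF (ltn_ord i)).
Qed.

(** * The recurrence shared by the two peak distributions *)

Section Transfer.
Variables (R : comNzRingType) (alpha beta c : R).

(** One insertion of a maximum, acting on test functions: with k peaks, 2k of n gaps keep the count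
    and n-2k raise it, while the gaps facing +oo keep it with total weight [c]. *)
Definition transfer (phi : nat -> R) (n k : nat) : R :=
  (c + (2 * k)%:R) * phi k + (n%:R - (2 * k)%:R) * phi k.+1.

Lemma sum_M0_rec n (phi : nat -> R) :
  \sum_(s : 'S_n.+1) phi (M0 s) * c ^+ rmi s
    = \sum_(s : 'S_n) transfer phi n (M0 s) * c ^+ rmi s.
Proof.
rewrite (sum_lift_perm ord_max); apply: eq_bigr => s _.
(* The boundary 0 is taken as first letter, which makes the leftmost gap an inner one; only the last
   gap faces +oo. *)
have lt_w : all (fun b => b < n.+1)%N (0%N :: word s).
  by apply/andP; split=> //; apply: sub_all (all_word s) => a /andP[].
have M0E i : M0 (lift_perm i ord_max s)
    = inner_peaks false 0 (insert n.+1 i (word s)).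
  by rewrite /M0 peaks_inner // word_lift /= map_bump_word_max.
rewrite big_ord_recr /= M0E rmi_lift_max eqxx -[ord_max : nat]/n.
have := insert_size n.+1 (word s); rewrite size_word => ->.
rewrite inner_peaks_rcons //.
rewrite -(peaks_inner s (leq0n n.+1)) // -/(M0 s).
under eq_bigr => i _.
  rewrite M0E rmi_lift_max /=.
  rewrite (_ : _ == ord_max = false) ?add0n; last first.
    by apply/negbTE; rewrite -val_eqE /= neq_ltn ltn_ord.
  over.
rewrite -mulr_suml.
have := sum_insert_max false phi lt_w; rewrite size_word => ->.
rewrite -(peaks_inner s (leq0n n.+1)) // -/(M0 s) /transfer -mul2n /= add1n exprS.
ring.
Qed.

Lemma sum_Mtilde_rec n (phi : nat -> R) : c = alpha + beta ->
  \sum_(s : 'S_n.+2) phi (Mtilde s) * (alpha ^+ (lmi s - 1) * beta ^+ (rmi s - 1))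
    = \sum_(s : 'S_n.+1) transfer phi n (Mtilde s)
        * (alpha ^+ (lmi s - 1) * beta ^+ (rmi s - 1)).
Proof.
move=> c_ab; rewrite (sum_lift_perm ord_max); apply: eq_bigr => s _.
case ws : (word s) => [|a w]; first by have := size_word s; rewrite ws.
have sw : size w = n by have := size_word s; rewrite ws => -[].
have lt_w : all (fun b => b < n.+2)%N (a :: w).
  by rewrite -ws; apply: sub_all (all_word s) => b /andP[].
have Mtilde_s : Mtilde s = inner_peaks false a w.
  rewrite /Mtilde peaks_inner // ws /=.
  by case/andP: lt_w => lt_an _; rewrite ltnNge ltnW.
have MtildeE i : Mtilde (lift_perm i ord_max s)
    = inner_peaks false n.+3 (insert n.+2 i (a :: w)).
  by rewrite /Mtilde peaks_inner // word_lift /= map_bump_word_max ws.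
under eq_bigr do rewrite MtildeE lmi_lift_max rmi_lift_max.
rewrite (sum_gaps n (fun b b' i => phi (inner_peaks false n.+3 (insert n.+2 i (a :: w)))
  * (alpha ^+ (b + lmi s - 1) * beta ^+ (b' + rmi s - 1)))).
rewrite [insert _ _ _]insert0 (_ : insert _ n.+1 _ = a :: rcons w n.+2); last first.
  by rewrite insertS -sw insert_size.
under eq_bigr => i _ do rewrite insertS /= !add0n.
rewrite /= inner_peaks_rcons // !add0n !add1n.
have lt_an : (a < n.+2)%N by case/andP: lt_w.
have [-> -> ->] : [/\ (n.+3 < a)%N = false, (n.+3 < n.+2)%N = false
    & (n.+2 < a)%N = false] by split; lia.
rewrite -mulr_suml; have := sum_insert_max false phi lt_w; rewrite sw => ->.
rewrite Mtilde_s /transfer /=.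
rewrite add0n -mul2n c_ab !subn1 /=.
have := lmi_gt0 s; have := rmi_gt0 s.
case: (lmi s) (rmi s) => [|l] [|l'] //= _ _; rewrite !exprS.
ring.
Qed.

End Transfer.

Lemma peaks_bound n (s : 'S_n) l r : (l <= r)%N -> (n < r)%N ->
  (2 * peaks l r s <= n)%N.
Proof.
move=> le_lr lt_nr; rewrite peaks_inner //.
by have := inner_peaks_bound false l (word s); rewrite size_word addn0.
Qed.

Lemma M0_perm0 (s : 'S_0) : M0 s = 0%N.
Proof.
have := peaks_bound s (leq0n 1) (ltn0Sn 0); rewrite -/(M0 s); lia.
Qed.

Lemma rmi_perm0 (s : 'S_0) : rmi s = 0%N.
Proof. by apply/eqP; rewrite -leqn0 -[leqRHS](card_ord 0) max_card. Qed.

Lemma sum_perm_le1 (V : nmodType) n (F : 'S_n -> V) : (n <= 1)%N ->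
  \sum_s F s = F 1%g.
Proof.
move=> le_n1; rewrite (bigD1 1%g) //= big1 ?addr0 // => s /eqP[].
apply/permP=> i; apply/val_inj => /=; rewrite perm1.
have := ltn_ord (s i); have := ltn_ord i; lia.
Qed.

(** Induction with [phi] general, because each step replaces [phi] by [transfer phi n], the same
    function on both sides. *)
Lemma sum_Mtilde_M0 (R : comNzRingType) (alpha beta : R) n (phi : nat -> R) :
  \sum_(s : 'S_n.+1) phi (Mtilde s) * (alpha ^+ (lmi s - 1) * beta ^+ (rmi s - 1))
    = \sum_(s : 'S_n) phi (M0 s) * (alpha + beta) ^+ rmi s.
Proof.
elim: n phi => [|n IHn] phi; last first.
  by rewrite (sum_Mtilde_rec _ _ (erefl _)) IHn sum_M0_rec.
rewrite !sum_perm_le1 //.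
have Mt0 : Mtilde (1%g : 'S_1) = 0%N.
  have := @peaks_bound 1 1%g 2 2 isT isT; rewrite -/(Mtilde _); lia.
have [le_l le_r] : (lmi (1%g : 'S_1) <= 1)%N /\ (rmi (1%g : 'S_1) <= 1)%N.
  by split; rewrite -[leqRHS](card_ord 1) max_card.
rewrite Mt0 M0_perm0 rmi_perm0.
by move: le_l le_r; rewrite -!subn_eq0 => /eqP-> /eqP->; rewrite !expr0 !mulr1.
Qed.

(** * The Stirling-Eulerian polynomial *)

(** A new minimum at the left end adds an ascent and a left-to-right maximum, at the right end a
    descent and a right-to-left maximum; inside an ascent it adds a descent, and inside a descent an
    ascent. *)
Lemma sum_asc_des_rec (R : comNzRingType) (a b : R) n (phi : nat -> nat -> R) :
  \sum_(s : 'S_n.+2) phi (asc s) (des s) * (a ^+ (lma s - 1) * b ^+ (rma s - 1))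
    = \sum_(s : 'S_n.+1) (a * phi (asc s).+1 (des s) + b * phi (asc s) (des s).+1
        + phi (asc s) (des s).+1 *+ asc s + phi (asc s).+1 (des s) *+ des s)
        * (a ^+ (lma s - 1) * b ^+ (rma s - 1)).
Proof.
rewrite (sum_lift_perm ord0); apply: eq_bigr => s _.
case ws : (word s) => [|c w]; first by have := size_word s; rewrite ws.
have sw : size w = n by have := size_word s; rewrite ws => -[].
have ws' i : word (lift_perm i ord0 s) = insert 1 i (c.+1 :: map S w).
  by rewrite word_lift map_bump_word_min ws.
have gt_w : all (ltn 1) (c.+1 :: map S w).
  have := all_word s; rewrite ws -[c.+1 :: _]/(map S (c :: w)) all_map.
  by apply: sub_all => d /andP[].
have uniq_w : uniq (c.+1 :: map S w).
  by rewrite -[c.+1 :: _]/(map S (c :: w)) map_inj_uniq -?ws ?uniq_word // => ? ? [].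
have asc_s : asc s = steps ltn c.+1 (map S w).
  by rewrite (asc_steps ws) steps_map.
have des_s : des s = steps gtn c.+1 (map S w).
  by rewrite (des_steps ws) steps_map.
(* Only the first gap changes the first letter of the word, hence the two forms. *)
pose P (b : bool) (i : nat) r := steps r (if b then 1%N else c.+1)
  (if b then c.+1 :: map S w else insert 1 i.-1 (map S w)).
have ascE i : asc (lift_perm i ord0 s) = P (i == ord0) i ltn.
  apply: asc_steps; rewrite ws' /P; have [->|i0] := eqVneq i ord0; first exact: insert0.
  by case: i i0 => -[].
have desE i : des (lift_perm i ord0 s) = P (i == ord0) i gtn.
  apply: des_steps; rewrite ws' /P; have [->|i0] := eqVneq i ord0; first exact: insert0.
  by case: i i0 => -[].
under eq_bigr do rewrite ascE desE lma_lift_min rma_lift_min.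
rewrite (sum_gaps n (fun f l i => phi (P f i ltn) (P f i gtn)
  * (a ^+ (f + lma s - 1) * b ^+ (l + rma s - 1)))) /P /=.
rewrite -mulr_suml; have := sum_insert_min phi gt_w uniq_w.
rewrite size_map sw => ->.
have := insert_size 1 (map S w); rewrite size_map sw => ->.
rewrite !steps_rcons -asc_s -des_s.
have last_gt1 : (1 < last c.+1 (map S w))%N by exact/(allP gt_w)/mem_last.
have -> : (1 < c.+1)%N by case/andP: gt_w.
rewrite /= last_gt1 [(_ < 1)%N]ltnNge (ltnW last_gt1) /= !add0n !addn0 !add1n !addn1.
have := lma_gt0 s; have := rma_gt0 s.
move: (lma s) (rma s) (asc s) (des s) => l r p q.
case: r => // r _; case: l => // l _.
rewrite !subn1 /= !exprS; ring.
Qed.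


Lemma deriv_monomial (R : comNzRingType) (p q : {poly R}) (u z : R) m k :
  ((p ^+ m * q ^+ k * z%:P)^`()).[u]
    = (p.[u] ^+ m.-1 * p^`().[u] * m%:R * q.[u] ^+ k
       + p.[u] ^+ m * (q.[u] ^+ k.-1 * q^`().[u] * k%:R)) * z.
Proof.
rewrite !derivM derivC mulr0 addr0 !deriv_exp.
rewrite !(hornerM, hornerD, hornerMn, horner_exp, hornerC); ring.
Qed.

(* Inserting a new minimum turns A_(n+1) into                                 *)
(* t (x + y) A_(n+1) + x y (d/dx + d/dy) A_(n+1); the derivative is obtained  *)
(* from the induction hypothesis at x + 'X, y + 'X, q + 'X in {poly R}.       *)
Lemma stirling_eulerian_M0 (R : comNzRingType) (x y q t : R) n : x + y = q *+ 2 ->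
  stirling_eulerian n.+1 x y t t
    = \sum_(s : 'S_n) (x * y) ^+ M0 s * q ^+ (n - 2 * M0 s) * (t *+ 2) ^+ rmi s.
Proof.
(* The ring is generalized because the induction hypothesis is also applied over [{poly R}]. *)
elim: n R x y q t => [|n IHn] R x y q t xy_q.
  rewrite /stirling_eulerian !sum_perm_le1 // M0_perm0 rmi_perm0 !expr0.
  have [[] le_a le_d [] le_l le_r] :
      ((asc (1%g : 'S_1) <= 0)%N /\ (des (1%g : 'S_1) <= 0)%N)
      /\ ((lma (1%g : 'S_1) <= 1)%N /\ (rma (1%g : 'S_1) <= 1)%N).
    by split; split; (rewrite -[leqRHS](card_ord 1)
      || rewrite -[leqRHS](card_ord 0)); rewrite max_card.
  move: le_a le_d le_l le_r; rewrite !leqn0 -!subn_eq0.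
  by move=> /eqP-> /eqP-> /eqP-> /eqP->; rewrite !expr0 !mulr1.
(* Moving [q] along with [x] and [y] preserves x + y = 2q, so q plays (x+y)/2 without any
   division. *)
have xy_q' : (x%:P + 'X) + (y%:P + 'X) = (q%:P + 'X) *+ 2 :> {poly R}.
  by rewrite addrACA -polyCD xy_q polyCMn; ring.
have := congr1 (fun p : {poly R} => p^`().[0]) (IHn _ _ _ _ t%:P xy_q').
rewrite /stirling_eulerian !raddf_sum /= -!horner_evalE !raddf_sum /=.
have ev0 (z : R) : (z%:P + 'X).[0] = z by rewrite !hornerE.
have dv0 (z : R) : (z%:P + 'X)^`().[0] = 1 by rewrite derivD derivC derivX !hornerE.
have dv0M : ((x%:P + 'X) * (y%:P + 'X))^`().[0] = x + y.
  by rewrite derivM hornerD !hornerM !ev0 !dv0 mul1r mulr1 addrC.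
under eq_bigr => s _.
  rewrite -!polyC_exp -mulrA -polyCM /horner_eval deriv_monomial !ev0 !dv0 !mulr1.
  over.
under [X in _ = X -> _]eq_bigr => s _.
  rewrite -polyCMn -polyC_exp /horner_eval deriv_monomial hornerM !ev0 dv0 dv0M mulr1.
  over.
move=> deriv_IHn.
have IHn0 := IHn _ _ _ _ t xy_q; rewrite /stirling_eulerian in IHn0.
under eq_bigr do rewrite -mulrA.
rewrite (sum_asc_des_rec t t n (fun p r => x ^+ p * y ^+ r)).
rewrite (sum_M0_rec _ n (fun k => (x * y) ^+ k * q ^+ (n.+1 - 2 * k))).
transitivity (t * (x + y) * (\sum_(s : 'S_n.+1)
      x ^+ asc s * y ^+ des s * t ^+ (lma s - 1) * t ^+ (rma s - 1))
  + x * y * (\sum_(s : 'S_n.+1) (x ^+ (asc s).-1 * (asc s)%:R * y ^+ des s +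
      x ^+ asc s * (y ^+ (des s).-1 * (des s)%:R)) *
     (t ^+ (lma s - 1) * t ^+ (rma s - 1)))).
  rewrite !mulr_sumr -big_split /=; apply: eq_bigr => s _.
  move: (asc s) (des s) => p r.
  by case: p => [|p]; case: r => [|r]; rewrite /= !exprS ?mulr0n; ring.
rewrite IHn0 deriv_IHn !mulr_sumr -big_split /=; apply: eq_bigr => s _.
have : (2 * M0 s <= n)%N by apply: peaks_bound.
rewrite /transfer; move: (M0 s) => k le_kn.
(* When n = 2k the exponent is truncated to 0, which is harmless as its coefficient n-2k
   vanishes. *)
rewrite -natrB // (_ : (n.+1 - 2 * k.+1 = (n - 2 * k).-1)%N); last by lia.
rewrite subSn //.
move: (n - 2 * k)%N => m.
rewrite xy_q.
by case: k le_kn => [|k] _; case: m => [|m]; rewrite /= ?subn1 /= !exprS; ring.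
Qed.

(** * Coefficients in the gamma basis *)

Lemma sum_M0_partition (R : pzRingType) n (F : nat -> R) (G : 'S_n -> R) :
  \sum_s F (M0 s) * G s
    = \sum_(0 <= k < (n./2).+1) F k * \sum_(s in Lset n k) G s.
Proof.
rewrite big_mkord.
have M0_lt (s : 'S_n) : (M0 s < (n./2).+1)%N.
  have := peaks_bound s (leq0n n.+1) (ltnSn n); rewrite -/(M0 s) ltnS; lia.
rewrite (partition_big (fun s => Ordinal (M0_lt s)) xpredT) //=.
apply: eq_bigr => k _; rewrite mulr_sumr; apply: eq_big => [s|s /eqP<- //].
by rewrite inE -val_eqE.
Qed.

(* Setting y = 1, the k-th summand is g k * X^k plus higher order terms. *)
Lemma gamma_basis_free (R : comNzRingType) m (g : nat -> R) :
    \sum_(0 <= k < (m./2).+1) (g k)%:P%:P * ('X * 'X%:P) ^+ k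
      * ('X + 'X%:P) ^+ (m - 2 * k) = 0 :> {poly {poly R}} ->
  forall k, (k <= m./2)%N -> g k = 0.
Proof.
move=> /(congr1 (map_poly (horner_eval 1))); rewrite rmorph0 rmorph_sum /= => sum0.
have {}sum0 : \sum_(0 <= k < (m./2).+1) (g k)%:P * ('X^k * ('X + 1) ^+ (m - 2 * k)) = 0.
  rewrite -[RHS]sum0; apply: eq_bigr => k _.
  rewrite !rmorphM !rmorphXn rmorphM rmorphD /= !map_polyX !map_polyC /=.
  by rewrite /horner_eval hornerX hornerC mulr1 mulrA.
move=> k; elim/ltn_ind: k => k IHk le_k.
(* In the coefficient of X^k, summands with j > k vanish by the factor X^j and those with j < k by
   induction. *)
have /(congr1 (fun p : {poly R} => p`_k)) := sum0.
rewrite coef0 coef_sum (bigD1_seq k) ?iota_uniq ?mem_index_iota //=.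
rewrite big1_seq ?addr0 => [|j /andP[neq_jk _]].
  rewrite coefCM coefXnM ltnn subnn -horner_coef0 horner_exp !hornerE.
  by rewrite expr1n mulr1.
rewrite coefCM coefXnM; case: ltnP => [|le_jk]; first by rewrite mulr0.
have lt_jk : (j < k)%N by rewrite ltn_neqAle neq_jk.
by rewrite IHk ?mul0r // (leq_trans (ltnW lt_jk)).
Qed.

Theorem theorem4p2 (R : comUnitRingType) (alpha beta : R) (n : nat)
    (n_ge1 : (1 <= n)%N) :
  (forall k : nat,
     \sum_(s in Pset n k) alpha ^+ (lmi s - 1) * beta ^+ (rmi s - 1)
     = \sum_(s in Lset (n - 1) k) (alpha + beta) ^+ rmi s)
  /\
  ((2%:R : R) \is a GRing.unit ->
     (exists gamma : nat -> R, gamma_expansion n alpha beta gamma)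
     /\
     (forall gamma : nat -> R, gamma_expansion n alpha beta gamma ->
        forall k : nat, (k <= (n - 1)./2)%N ->
          gamma k = (2%:R : R) ^ ((2 * k + 1)%N%:Z - n%:Z)
                    * \sum_(s in Lset (n - 1) k) (alpha + beta) ^+ rmi s)).
Proof.
case: n n_ge1 => // n _; split=> [k|unit2].
  have indicator m (f : 'S_m -> nat) F :
      \sum_(s in [set s | f s == k]) F s = \sum_s (f s == k)%:R * F s :> R.
    rewrite big_mkcond; apply: eq_bigr => s _; rewrite inE.
    by case: ifP; rewrite ?mul1r ?mul0r.
  by rewrite subn1 !indicator (sum_Mtilde_M0 alpha beta n (fun j => (j == k)%:R)).
pose B k := \sum_(s in Lset n k) (alpha + beta) ^+ rmi s.
(* The power of 1/2 comes from q^(n-2k) with q = (x+y)/2. *)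
pose g k := 2%:R^-1 ^+ (n - 2 * k) * B k.
have expE (gamma : nat -> R) : gamma_expansion n.+1 alpha beta gamma <->
    \sum_(0 <= k < (n./2).+1) (g k)%:P%:P * ('X * 'X%:P) ^+ k
        * ('X + 'X%:P) ^+ (n - 2 * k)
      = \sum_(0 <= k < (n./2).+1) (gamma k)%:P%:P * ('X * 'X%:P) ^+ k
        * ('X + 'X%:P) ^+ (n - 2 * k) :> {poly {poly R}}.
  rewrite /gamma_expansion subn1 /=.
  under [X in _ = X]eq_bigr do rewrite subnAC subn1 /=.
  set A := stirling_eulerian _ _ _ _ _.
  suff -> : A = \sum_(0 <= k < (n./2).+1) (g k)%:P%:P * ('X * 'X%:P) ^+ k
        * ('X + 'X%:P) ^+ (n - 2 * k) by [].
  pose h : {poly {poly R}} := (2%:R^-1)%:P%:P.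
  have h2 : h *+ 2 = 1 by rewrite -mulr_natr -!polyC_natr -!polyCM mulVr.
  have xy_q : 'X + 'X%:P = (h * ('X + 'X%:P)) *+ 2 :> {poly {poly R}}.
    by rewrite -mulrnAl h2 mul1r.
  rewrite /A (stirling_eulerian_M0 _ _ xy_q).
  have -> : ((alpha + beta) / 2%:R)%:P%:P *+ 2 = (alpha + beta)%:P%:P :> {poly {poly R}}.
    by rewrite -!polyCMn -[_ *+ 2]mulr_natr mulrVK.
  rewrite (sum_M0_partition (fun k => ('X * 'X%:P) ^+ k * (h * ('X + 'X%:P)) ^+ (n - 2 * k))).
  apply: eq_bigr => k _.
  have -> : \sum_(s in Lset n k) (alpha + beta)%:P%:P ^+ rmi s = (B k)%:P%:P :> {poly {poly R}}.
    by rewrite !rmorph_sum; apply: eq_bigr => s _; rewrite !rmorphXn.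
  rewrite /g !polyCM !polyC_exp !exprMn -/h; ring.
split=> [|gamma /expE eq_g k]; first by exists g; apply/expE.
rewrite subn1 /= => le_k.
have -> : gamma k = g k.
  apply/eqP; rewrite eq_sym -subr_eq0; apply/eqP.
  apply: (@gamma_basis_free _ n (fun j => g j - gamma j)) => //.
  under eq_bigr do rewrite !polyCB !mulrBl.
  by rewrite sumrB eq_g subrr.
congr (_ * _).
(* Here n stands for the original n minus 1, and k <= n/2 keeps n-2k from being truncated. *)
rewrite (_ : _ - _ = - (n - 2 * k)%N%:Z); last by lia.
by rewrite -exprnN exprVn.
Qed.
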